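(* Consider an instance of the Fixed single-product lot-sizing problem $\mathrm{LSP}(F,1)$ with integer production rate $p_1$, integer demand rate $d_1$ and holding cost $h_1>0$, where $p_1\ge d_1\ge 1$. In an optimal schedule $S^*$, for every time unit $t$, we have $\pi_1^t>0$ if and only if $q_1^{t-1}<d_1$.
   Context: $\mathrm{LSP}(F,1)$: a single machine produces a single product. Time is divided into unit periods $[t-1,t]$, $t=1,2,\dots$. In each period the machine either produces nothing, or produces exactly the full amount $p_1$; let $\pi_1^t\in\{0,p_1\}$ be the amount produced in period $[t-1,t]$. In each period a demand $d_1$ must be met. The stock level at time $t$ satisfies $q_1^t=q_1^{t-1}+\pi_1^t-d_1$, and no backlogs are allowed, i.e. $q_1^t\ge 0$ for all $t$. A feasible cyclic schedule of length $C$ (a positive integer) consists of an initial stock $q_1^0\ge 0$ (part of the schedule) and production amounts $\pi_1^1,\dots,\pi_1^C$ such that $q_1^t\ge0$ for all $t$ and $q_1^C=q_1^0$; it is repeated periodically. Holding costs are paid at the end of each time unit: $h_1q_1^t$ at time $t$. There are no switching costs since there is only one product. The average cost per unit of time is $\bar c(S)=\frac1C\sum_{t=1}^{C}h_1q_1^t$. A schedule is optimal if it minimizes $\bar c$ among all feasible cyclic schedules, of any length. *)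

(* Defs.v *)
From HB Require Import structures.
From mathcomp Require Import all_boot all_order all_algebra.
From mathcomp Require Import reals.

Set Implicit Arguments.
Unset Strict Implicit.
Unset Printing Implicit Defensive.

Import Order.TTheory GRing.Theory Num.Theory.
Local Open Scope ring_scope.

(* [amounts] lists pi^1, ..., pi^C, so its size is the cycle length C. *)
Record schedule (R : realType) := Schedule {
  init_stock : R;
  amounts : seq R
}.

Section LotSizing.

Variable R : realType.
Implicit Types (S : schedule R) (p d t : nat) (h : R).

Definition cycle_length S : nat := size (amounts S).

(* pi^t, the amount produced in the period [t-1, t] of the periodic repetition
   of S; only meaningful for t >= 1. *)
Definition production S t : R := (amounts S)`_(t.-1 %% cycle_length S).

Fixpoint stock d S t : R :=
  if t is t'.+1 then stock d S t' + production S t - d%:R else init_stock S.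

Definition feasible p d S : Prop :=
  [/\ (0 < cycle_length S)%N,
      forall x, x \in amounts S -> x = 0 \/ x = p%:R,
      forall t, 0 <= stock d S t
    & stock d S (cycle_length S) = stock d S 0].

Definition average_cost d h S : R :=
  (\sum_(1 <= t < (cycle_length S).+1) h * stock d S t) / (cycle_length S)%:R.

Definition optimal p d h S : Prop :=
  feasible p d S /\
  forall S', feasible p d S' -> average_cost d h S <= average_cost d h S'.

End LotSizing.

(* Main.v *)
Require Import Defs.
From HB Require Import structures.
From mathcomp Require Import all_boot all_order all_algebra.
From mathcomp Require Import reals.
From mathcomp Require Import lra.

Set Implicit Arguments.
Unset Strict Implicit.
Unset Printing Implicit Defensive.

Import Order.TTheory GRing.Theory Num.Theory.
Local Open Scope ring_scope.

(** Without backlogs, a stock below [d] forces production.  Conversely,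
    producing on a stock of at least [d] raises it to at least [p], so it
    suffices that the stock of an optimal schedule never reaches [p].

    This holds because any feasible schedule can be improved by reducing every
    stock level modulo [p] ([reduced_schedule]).  Reduction changes each amount
    produced by a multiple of [p]; since the reduced levels lie in [0, p[ and
    [1 <= d <= p], the new amount lies strictly between [- p] and [2 p], so it
    is again [0] or [p] ([reduced_production]).  The reduced stock is as
    periodic as the original one, it is nonnegative, and it is nowhere above
    the original, strictly below it where the original is at least [p].  As
    [h > 0] and the cycle length is unchanged, one level of at least [p] in the
    cycle makes the reduced schedule strictly cheaper ([optimal_stock_lt]). *)

Section Residue.

Variables (R : realType) (p : nat).
Hypothesis p_gt0 : (0 < p)%N.
Implicit Types x : R.

Definition residue x : R := x - p%:R * (Num.floor (x / p%:R))%:~R.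

Let pR_gt0 : 0 < p%:R :> R. Proof. by rewrite ltr0n. Qed.

Lemma residue_ge0 x : 0 <= residue x.
Proof.
rewrite /residue subr_ge0 mulrC -ler_pdivlMr //.
exact: floor_le.
Qed.

Lemma residue_lt x : residue x < p%:R.
Proof.
rewrite /residue ltrBlDr -[X in X + _]mulr1 -mulrDr mulrC -ltr_pdivrMr //.
have := floorD1_gt (x / p%:R); rewrite intrD; lra.
Qed.

Lemma residue_le x : 0 <= x -> residue x <= x.
Proof.
move=> x_ge0; rewrite /residue gerBl mulr_ge0 ?ler0n // ler0z.
by rewrite floor_ge0 divr_ge0 // ler0n.
Qed.

End Residue.

Section Reduction.

Variables (R : realType) (p d : nat) (S : schedule R).
Hypotheses (d_ge1 : (1 <= d)%N) (d_le_p : (d <= p)%N).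
Hypothesis S_feas : feasible p d S.

Let p_gt0 : (0 < p)%N := leq_trans d_ge1 d_le_p.
Let C := cycle_length S.
Let C_gt0 : (0 < C)%N. Proof. by case: S_feas. Qed.
Let q t : R := stock d S t.
Let q_ge0 t : 0 <= q t. Proof. by case: S_feas. Qed.

Lemma production_eq t : production S t = 0 \/ production S t = p%:R.
Proof.
case: S_feas => _ amountsP _ _; apply: amountsP.
by rewrite mem_nth // ltn_mod.
Qed.

Lemma stock_addC t : q (C + t) = q t.
Proof.
elim: t => [|t IHt]; first by rewrite addn0; case: S_feas.
by rewrite addnS /q /= -/(q _) IHt /production /= -/C modnDl.
Qed.

Lemma stock_mod t : q (t %% C) = q t.
Proof.
rewrite {2}(divn_eq t C); elim: (t %/ C)%N => [|k IHk]; first by rewrite add0n.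
by rewrite mulSn -addnA stock_addC.
Qed.

(** Unlike [stock_mod], this form sends every [t.+1] to an index in [1 .. C],
    the range over which holding costs are summed. *)
Lemma stock_modS t : q (t %% C).+1 = q t.+1.
Proof.
by rewrite /q /= -/(q _) -/(q t) stock_mod /production /= -/C modn_mod.
Qed.

(** The amounts are those forced by the wish that the stock at time [t] be the
    residue of [q t]. *)
Definition reduced_schedule : schedule R :=
  Schedule (residue p (q 0))
    (mkseq (fun t => residue p (q t.+1) - residue p (q t) + d%:R) C).

Lemma reduced_length : cycle_length reduced_schedule = C.
Proof. by rewrite /cycle_length /= size_mkseq. Qed.

Lemma reduced_stock t : stock d reduced_schedule t = residue p (q t).
Proof.
elim: t => //= t ->; rewrite /production /= reduced_length.
by rewrite nth_mkseq ?ltn_mod // stock_modS stock_mod addrA addrK addrC subrK.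
Qed.

(** The new amount differs from the old one by a multiple of [p], and the
    bounds on residues confine it to the interval ]d - p, d + p[, in which
    [0] and [p] are the only possible multiples of [p] because [1 <= d <= p]. *)
Lemma reduced_production t :
  let x := residue p (q t.+1) - residue p (q t) + d%:R in x = 0 \/ x = p%:R.
Proof.
move=> x.
have pR_gt0 : 0 < p%:R :> R by rewrite ltr0n.
have [z xE] : exists z : int, x = p%:R * z%:~R.
  have [b prodE] : exists b : int, production S t.+1 = p%:R * b%:~R.
    by case: (production_eq t.+1) => ->; [exists 0 | exists 1];
       rewrite ?mulr0 ?mulr1.
  exists (b - Num.floor (q t.+1 / p%:R) + Num.floor (q t / p%:R)).
  have qE : q t.+1 = q t + p%:R * b%:~R - d%:R by rewrite -prodE.
  rewrite /x /residue intrD intrB; move: qE.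
  move: (Num.floor _)%:~R (Num.floor _)%:~R => u v ->; lra.
have z_gtN1 : -1 < z.
  rewrite -(ltr_int R) -(ltr_pM2l pR_gt0) -xE rmorphN1 mulrN1 /x.
  have d_gt0 : 0 < d%:R :> R by rewrite ltr0n.
  have := residue_ge0 p_gt0 (q t.+1); have := residue_lt p_gt0 (q t); lra.
have z_lt2 : z < 2.
  rewrite -(ltr_int R) -(ltr_pM2l pR_gt0) -xE /x.
  have : d%:R <= p%:R :> R by rewrite ler_nat.
  have := residue_ge0 p_gt0 (q t); have := residue_lt p_gt0 (q t.+1).
  rewrite -[2%:~R]/(2%:R : R); lra.
rewrite xE; case: z z_gtN1 z_lt2 {xE} => [[|[|n]]|n] //= _ _.
- by left; rewrite mulr0.
- by right; rewrite mulr1.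
Qed.

Lemma reduced_feasible : feasible p d reduced_schedule.
Proof.
split; first by rewrite reduced_length.
- by move=> x /mapP[t _ ->]; apply: reduced_production.
- by move=> t; rewrite reduced_stock residue_ge0.
- by rewrite reduced_length !reduced_stock -[C]addn0 stock_addC.
Qed.

(** The period in the cycle that corresponds to [t.+1] gives a strict decrease;
    no other period gets more expensive. *)
Lemma reduced_average_cost_lt (h : R) t : 0 < h -> p%:R <= q t.+1 ->
  average_cost d h reduced_schedule < average_cost d h S.
Proof.
move=> h_gt0 q_ge_p; rewrite /average_cost reduced_length -/C.
rewrite ltr_pM2r ?invr_gt0 ?ltr0n // !big_add1 /= !big_mkord.
pose i : 'I_C := Ordinal (ltn_pmod t C_gt0).
rewrite (bigD1 i) //= [ltRHS](bigD1 i) //=; apply: ltr_leD.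
  rewrite ltr_pM2l // -!/(stock d _ _.+1) reduced_stock -/(q _) stock_modS.
  exact: lt_le_trans (residue_lt p_gt0 _) q_ge_p.
apply: ler_sum => j _.
by rewrite ler_pM2l // -!/(stock d _ _.+1) reduced_stock residue_le // q_ge0.
Qed.

End Reduction.

Lemma optimal_stock_lt (R : realType) (p d : nat) (h : R) (S : schedule R) t :
  (1 <= d)%N -> (d <= p)%N -> 0 < h -> optimal p d h S ->
  stock d S t.+1 < p%:R.
Proof.
move=> d_ge1 d_le_p h_gt0 [S_feas S_min]; rewrite ltNge; apply/negP => q_ge_p.
have := S_min _ (reduced_feasible d_ge1 d_le_p S_feas).
by rewrite leNgt (reduced_average_cost_lt d_ge1 d_le_p S_feas h_gt0 q_ge_p).
Qed.

Theorem theorem1 (R : realType) (p d : nat) (h : R)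
    (d_ge1 : (1 <= d)%N) (d_le_p : (d <= p)%N) (h_gt0 : 0 < h)
    (S : schedule R) (S_opt : optimal p d h S) (t : nat) (t_ge1 : (1 <= t)%N) :
  0 < production S t <-> stock d S t.-1 < d%:R.
Proof.
case: t t_ge1 => // t _ /=.
have [S_feas _] := S_opt.
have stockS : stock d S t.+1 = stock d S t + production S t.+1 - d%:R by [].
have stock_ge0 : 0 <= stock d S t.+1 by case: S_feas.
have stock_lt := optimal_stock_lt t d_ge1 d_le_p h_gt0 S_opt.
have p_gt0 : 0 < p%:R :> R by rewrite ltr0n (leq_trans d_ge1).
by case: (production_eq S_feas t.+1) => prodE; rewrite prodE in stockS *;
   split=> ?; lra.
Qed.
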